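(* Let $L,M,N$ be positive integers and let $g:=\{g_l\}_{l\in\mathbb{N}_L}\subset\ell^2(\mathbb{Z}\times\mathbb{Z},\mathbb{H})$. Assume that $\mathcal{G}(g,L,M,N)$ is a Parseval frame for $\ell^2(\mathbb{Z}\times\mathbb{Z},\mathbb{H})$. Then the following statements are equivalent: 1. $\mathcal{G}(g,L,M,N)$ is an orthonormal basis for $\ell^2(\mathbb{Z}\times\mathbb{Z},\mathbb{H})$. 2. $N^2=LM^2$.
   Context: $\mathbb{H}$ is the algebra of real quaternions with imaginary units $i,j,ij$. For a positive integer $K$, $\mathbb{N}_K:=\{0,1,\dots,K-1\}$. $\ell^2(\mathbb{Z}\times\mathbb{Z},\mathbb{H})$ is the right quaternionic Hilbert space of functions $f:\mathbb{Z}^2\to\mathbb{H}$ with $\sum_{k\in\mathbb{Z}^2}|f(k)|^2<\infty$, with inner product $\langle f,g\rangle=\sum_{k\in\mathbb{Z}^2}\overline{f(k)}\,g(k)$ and scalars acting on the right. For $n\in\mathbb{Z}^2$, $(T_{nN}f)(k)=f(k-nN)$ where $nN=(n_1N,n_2N)$. For $m=(m_1,m_2)\in\mathbb{N}_M^2$, $(E_{\frac mM}f)(k)=e^{2\pi i\frac{m_1}{M}k_1}f(k)e^{2\pi j\frac{m_2}{M}k_2}$, $k=(k_1,k_2)\in\mathbb{Z}^2$. The Gabor system is the indexed family $\mathcal{G}(g,L,M,N):=\{E_{\frac mM}T_{nN}g_l\}_{l\in\mathbb{N}_L,\,m\in\mathbb{N}_M^2,\,n\in\mathbb{Z}^2}$.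 It is a Parseval frame if for all $h\in\ell^2(\mathbb{Z}\times\mathbb{Z},\mathbb{H})$: $\sum_{l\in\mathbb{N}_L}\sum_{n\in\mathbb{Z}^2}\sum_{m\in\mathbb{N}_M^2}|\langle E_{\frac mM}T_{nN}g_l,h\rangle|^2=\|h\|^2$. *)

(* Defs.v *)
From HB Require Import structures.
From mathcomp Require Import all_boot all_order all_algebra ring.
From mathcomp Require Import boolp classical_sets functions reals.
From mathcomp Require Import constructive_ereal ereal esum trigo.
Set Implicit Arguments.
Unset Strict Implicit.
Unset Printing Implicit Defensive.
Import Order.TTheory GRing.Theory Num.Theory.
Local Open Scope ring_scope.

(* [Quat a b c d] is a + b i + c j + d ij. *)
Record quat (R : Type) :=
  Quat { qre : R ; qim_i : R ; qim_j : R ; qim_ij : R }.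
Arguments qre {R} _.
Arguments qim_i {R} _.
Arguments qim_j {R} _.
Arguments qim_ij {R} _.

Definition quat_tuple (R : Type) (x : quat R) : R * R * R * R :=
  (qre x, qim_i x, qim_j x, qim_ij x).
Definition tuple_quat (R : Type) (t : R * R * R * R) : quat R :=
  Quat t.1.1.1 t.1.1.2 t.1.2 t.2.
Lemma quat_tupleK (R : Type) : cancel (@quat_tuple R) (@tuple_quat R).
Proof. by case. Qed.

HB.instance Definition _ (R : eqType) :=
  Equality.copy (quat R) (can_type (@quat_tupleK R)).
HB.instance Definition _ (R : choiceType) :=
  Choice.copy (quat R) (can_type (@quat_tupleK R)).

Section QuatRing.
Context {R : comNzRingType}.
Implicit Types x y z : quat R.

Definition qzero : quat R := Quat 0 0 0 0.
Definition qone : quat R := Quat 1 0 0 0.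
Definition qopp x := Quat (- qre x) (- qim_i x) (- qim_j x) (- qim_ij x).
Definition qadd x y :=
  Quat (qre x + qre y) (qim_i x + qim_i y) (qim_j x + qim_j y)
       (qim_ij x + qim_ij y).
Definition qmul x y :=
  let: Quat a b c d := x in let: Quat a' b' c' d' := y in
  Quat (a * a' - b * b' - c * c' - d * d')
       (a * b' + b * a' + c * d' - d * c')
       (a * c' - b * d' + c * a' + d * b')
       (a * d' + b * c' - c * b' + d * a').

Fact qaddA : associative qadd.
Proof. by move=> x y z; rewrite /qadd /= !addrA. Qed.
Fact qaddC : commutative qadd.
Proof. by move=> x y; congr Quat; exact: addrC. Qed.
Fact qadd0 : left_id qzero qadd.
Proof. by case=> a b c d; rewrite /qadd /= !add0r. Qed.
Fact qaddN : left_inverse qzero qopp qadd.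
Proof. by case=> a b c d; rewrite /qadd /= !addNr. Qed.

HB.instance Definition _ :=
  GRing.isZmodule.Build (quat R) qaddA qaddC qadd0 qaddN.

Fact qmulA : associative qmul.
Proof. by case=> ? ? ? ? [] ? ? ? ? [] ? ? ? ? /=; congr Quat; ring. Qed.
Fact qmul1l : left_id qone qmul.
Proof. by case=> ? ? ? ? /=; congr Quat; ring. Qed.
Fact qmul1r : right_id qone qmul.
Proof. by case=> ? ? ? ? /=; congr Quat; ring. Qed.
Fact qmulDl : left_distributive qmul +%R.
Proof. by case=> ? ? ? ? [] ? ? ? ? [] ? ? ? ? /=; congr Quat => /=; ring. Qed.
Fact qmulDr : right_distributive qmul +%R.
Proof. by case=> ? ? ? ? [] ? ? ? ? [] ? ? ? ? /=; congr Quat => /=; ring. Qed.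
Fact qone_neq0 : qone != 0 :> quat R.
Proof. by apply/eqP => -[] /eqP; rewrite oner_eq0. Qed.

HB.instance Definition _ :=
  GRing.Zmodule_isNzRing.Build (quat R)
    qmulA qmul1l qmul1r qmulDl qmulDr qone_neq0.

Definition qconj x := Quat (qre x) (- qim_i x) (- qim_j x) (- qim_ij x).

End QuatRing.

Definition qnorm {R : realType} (x : quat R) : R :=
  Num.sqrt (qre x ^+ 2 + qim_i x ^+ 2 + qim_j x ^+ 2 + qim_ij x ^+ 2).

(* e^(i t) and e^(j t), by Euler's formula *)
Definition expi {R : realType} (t : R) : quat R := Quat (cos t) (sin t) 0 0.
Definition expj {R : realType} (t : R) : quat R := Quat (cos t) 0 (sin t) 0.

(* The unconditional sum of an absolutely summable family (positive part minus
   negative part); not meaningful for other families. *)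
Definition rsum {R : realType} {T : choiceType} (f : T -> R) : R :=
  fine (\esum_(t in setT) (Num.max (f t) 0)%:E)
  - fine (\esum_(t in setT) (Num.max (- f t) 0)%:E).

Definition qsum {R : realType} {T : choiceType} (f : T -> quat R) : quat R :=
  Quat (rsum (qre \o f)) (rsum (qim_i \o f))
       (rsum (qim_j \o f)) (rsum (qim_ij \o f)).

Definition Z2 : choiceType := (int * int)%type.

Definition normsq {R : realType} (f : Z2 -> quat R) : \bar R :=
  \esum_(k in setT) (qnorm (f k) ^+ 2)%:E.

Definition l2 {R : realType} (f : Z2 -> quat R) : Prop := (normsq f < +oo)%E.

(* For f and g in l2 the family below is absolutely summable, by
   Cauchy-Schwarz, so that qsum is its sum. *)
Definition inner {R : realType} (f g : Z2 -> quat R) : quat R :=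
  qsum (fun k => qconj (f k) * g k).

(* Density of the right-linear span: scalars multiply on the right. *)
Definition right_total {R : realType} {I : choiceType}
    (u : I -> Z2 -> quat R) : Prop :=
  forall h : Z2 -> quat R, l2 h -> forall e : R, 0 < e ->
  exists (s : seq I) (q : I -> quat R),
    (normsq (fun k => h k - \sum_(a <- s) u a k * q a)%R < (e ^+ 2)%:E)%E.

Definition orthonormal {R : realType} {I : choiceType}
    (u : I -> Z2 -> quat R) : Prop :=
  forall a b : I, inner (u a) (u b) = (a == b)%:R.

Definition orthonormal_basis {R : realType} {I : choiceType}
    (u : I -> Z2 -> quat R) : Prop :=
  [/\ forall a, l2 (u a), orthonormal u & right_total u].

Definition translation {R : realType} (N : nat) (n : Z2)
    (f : Z2 -> quat R) : Z2 -> quat R :=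
  fun k => f (k.1 - n.1 * N%:Z, k.2 - n.2 * N%:Z).

Definition modulation {R : realType} (M : nat) (m : 'I_M * 'I_M)
    (f : Z2 -> quat R) : Z2 -> quat R :=
  fun k => expi (2 * pi * (m.1%:R / M%:R) * k.1%:~R) * f k
           * expj (2 * pi * (m.2%:R / M%:R) * k.2%:~R).

Definition gabor_index (L M : nat) : choiceType :=
  ('I_L * ('I_M * 'I_M) * Z2)%type.

Definition gabor {R : realType} (L M N : nat) (g : 'I_L -> Z2 -> quat R)
    (a : gabor_index L M) : Z2 -> quat R :=
  let: (l, m, n) := a in modulation m (translation N n (g l)).

Definition gabor_parseval {R : realType} (L M N : nat)
    (g : 'I_L -> Z2 -> quat R) : Prop :=
  forall h : Z2 -> quat R, l2 h ->
  (\sum_(l < L) \esum_(n in [set: Z2]) \sum_(m : 'I_M * 'I_M)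
     (qnorm (inner (gabor N g (l, m, n)) h) ^+ 2)%:E = normsq h)%E.

(* Main.v *)
(* Testing the Parseval identity on the unit vector at k gives
   M^2 sum_(l,n) |g_l(k - n N)|^2 = 1, because modulations do not change
   absolute values; summing over k in a box of side N yields
   M^2 sum_l ||g_l||^2 = N^2.  Elements of a Parseval frame have norm at most 1,
   and the frame is an orthonormal basis exactly when they all have norm 1.
   As the elements of the Gabor system have the norms of the L windows g_l, this
   happens iff sum_l ||g_l||^2 = L, that is iff N^2 = L M^2. *)
Require Import Defs.
From mathcomp Require Import all_boot all_order all_algebra.
From mathcomp Require Import reals.
From mathcomp Require Import ring lra.
From mathcomp Require Import boolp classical_sets functions cardinality fsbigop.
From mathcomp Require Import constructive_ereal ereal esum trigo.
Set Implicit Arguments.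
Unset Strict Implicit.
Unset Printing Implicit Defensive.
Import Order.TTheory GRing.Theory Num.Theory.
Local Open Scope classical_set_scope.
Local Open Scope ring_scope.

(** * Sums of nonnegative extended reals *)

Lemma esumZl (R : realType) (T : choiceType) (D : set T) (c : R)
    (f : T -> \bar R) : 0 <= c -> (forall t, 0 <= f t)%E ->
  (\esum_(t in D) (c%:E * f t) = c%:E * \esum_(t in D) f t)%E.
Proof.
have le (d : R) (h : T -> \bar R) : 0 < d -> (forall t, 0 <= h t)%E ->
    (\esum_(t in D) (d%:E * h t) <= d%:E * \esum_(t in D) h t)%E.
  move=> d0 h0; apply: ge_ereal_sup => _ [X [finX XD] <-].
  rewrite fsbig_finite//= -ge0_sume_distrr//.
  rewrite lee_pmul2l ?lte_fin// -fsbig_finite//.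
  by apply: ereal_sup_ubound; exists X.
rewrite le_eqVlt => /predU1P[<- f0|c0 f0].
  by rewrite mul0e esum1// => t _; rewrite mul0e.
apply/eqP; rewrite eq_le le//= -lee_pdivlMl//.
(* The reverse inequality is [le] again, for the factor [c^-1] and the family [c * f]. *)
rewrite [leLHS](_ : _ = \esum_(t in D) (c^-1%:E * (c%:E * f t)))%E.
  by rewrite le ?invr_gt0// => t; rewrite mule_ge0// lee_fin ltW.
by apply: eq_esum => t _; rewrite muleA -EFinM mulVf ?mul1e// gt_eqF.
Qed.

Lemma esum_finType (R : realType) (I : finType) (F : I -> \bar R) :
  (forall i, 0 <= F i)%E -> (\esum_(i in [set: I]) F i = \sum_i F i)%E.
Proof.
have finI : finite_set [set: I] := @finite_finset I setT.
move=> F0; rewrite esum_fset// fsbig_finite// big_uniq ?finmap.fset_uniq//.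
by apply: eq_bigl => i; rewrite in_fset_set// mem_setT.
Qed.

Lemma esum_fin_prod (R : realType) (I : finType) (T : choiceType)
    (F : I * T -> \bar R) : (forall p, 0 <= F p)%E ->
  (\esum_(p in [set: I * T]) F p
   = \sum_i \esum_(t in [set: T]) F (i, t))%E.
Proof.
move=> F0; rewrite -esum_finType => [|i]; last exact: esum_ge0.
rewrite (@esum_esum _ _ _ [set: I] (fun=> [set: T]) (fun i t => F (i, t)))//.
have -> : ([set: I] `*`` (fun=> [set: T]) = [set: I * T])%classic.
  by apply/seteqP; split.
by apply: eq_esum => -[].
Qed.

Lemma le_esum1 (R : realType) (T : choiceType) (F : T -> \bar R) (t : T) :
  (forall s, 0 <= F s)%E -> (F t <= \esum_(s in [set: T]) F s)%E.
Proof.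
move=> F0; rewrite (esumID [set t])// setTI esum_set1// leeDl//.
exact: esum_ge0.
Qed.

Lemma esum_single (R : realType) (T : choiceType) (F : T -> \bar R) (t : T) :
  (0 <= F t)%E -> (forall s, s != t -> F s = 0%E) ->
  (\esum_(s in [set: T]) F s = F t)%E.
Proof.
move=> Ft0 F0; have Fs0 s : (0 <= F s)%E.
  by have [->//|/F0 ->] := eqVneq s t.
rewrite (esumID [set t])// setTI esum_set1// esum1 ?adde0// => s [_ /= /eqP].
exact: F0.
Qed.

(** * Absolutely summable real families and linearity of [rsum] *)

Definition rsummable {R : realType} {T : choiceType} (f : T -> R) :=
  (\esum_(t in [set: T]) `|f t|%:E < +oo)%E.

Section RealSums.
Context {R : realType} {T : choiceType}.
Implicit Types f h p q : T -> R.

Lemma rsummable_le f h : (forall t, `|f t| <= h t) ->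
  (\esum_(t in [set: T]) (h t)%:E < +oo)%E -> rsummable f.
Proof.
by move=> fh; apply: le_lt_trans; apply: le_esum => t _; rewrite lee_fin.
Qed.

Lemma rsummableD f h : rsummable f -> rsummable h ->
  rsummable (fun t => f t + h t).
Proof.
move=> sf sh; apply: (@rsummable_le _ (fun t => `|f t| + `|h t|)).
  by move=> t; exact: ler_normD.
rewrite (_ : esum _ _ = (\esum_(t in [set: T]) `|f t|%:E
                       + \esum_(t in [set: T]) `|h t|%:E))%E.
  exact: lte_add_pinfty.
by rewrite -esumD// => t _; rewrite lee_fin.
Qed.

Lemma rsummableZ c f : rsummable f -> rsummable (fun t => c * f t).
Proof.
move=> sf; rewrite /rsummable.
under eq_esum do rewrite normrM EFinM.
rewrite esumZl ?normr_ge0//.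
by rewrite lte_mul_pinfty// ?lee_fin.
Qed.

Lemma rsummableN f : rsummable f -> rsummable (fun t => - f t).
Proof. by rewrite /rsummable; under [in X in _ -> X]eq_esum do rewrite normrN. Qed.

Let pos f t := Num.max (f t) 0.
Let neg f t := Num.max (- f t) 0.

Let pos_ge0 f t : 0 <= pos f t. Proof. by rewrite le_max lexx orbT. Qed.
Let neg_ge0 f t : 0 <= neg f t. Proof. by rewrite le_max lexx orbT. Qed.

Let summable_pos f : rsummable f -> rsummable (pos f).
Proof.
apply: rsummable_le => t; rewrite ger0_norm//.
by rewrite ge_max ler_norm normr_ge0.
Qed.

Let summable_neg f : rsummable f -> rsummable (neg f).
Proof. by move=> /rsummableN/summable_pos. Qed.

Let posBneg f t : f t = pos f t - neg f t.
Proof.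
rewrite /pos /neg; have [h|h] := leP 0 (f t).
  by rewrite max_r ?oppr_le0// subr0.
by rewrite max_l; lra.
Qed.

Let fin_num_esum p : (forall t, 0 <= p t) -> rsummable p ->
  (\esum_(t in [set: T]) (p t)%:E \is a fin_num)%E.
Proof.
move=> p0; rewrite /rsummable ge0_fin_numE; last first.
  by apply: esum_ge0 => t _; rewrite lee_fin.
by under eq_esum do rewrite ger0_norm//.
Qed.

(** Frees [rsum] from the particular splitting into positive and negative parts: any two splittings
    of f into summable nonnegative parts give the same difference. Additivity follows, since pos f +
    pos h and neg f + neg h split f + h, though they need not be its own positive and negative
    parts. *)
Let rsum_diff p q : (forall t, 0 <= p t) -> (forall t, 0 <= q t) ->
  rsummable p -> rsummable q ->
  rsum (fun t => p t - q t) = fine (\esum_(t in [set: T]) (p t)%:E)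
                            - fine (\esum_(t in [set: T]) (q t)%:E).
Proof.
move=> p0 q0 sp sq; set f := fun t => p t - q t.
have sf : rsummable f by apply: rsummableD => //; exact: rsummableN.
have posF := fin_num_esum (pos_ge0 f) (summable_pos sf).
have negF := fin_num_esum (neg_ge0 f) (summable_neg sf).
have pF := fin_num_esum p0 sp; have qF := fin_num_esum q0 sq.
(* The identity pos f - neg f = p - q is rearranged into sums of nonnegative terms, so that [esumD]
   applies before passing to finite values. *)
have : (\esum_(t in [set: T]) (pos f t)%:E + \esum_(t in [set: T]) (q t)%:E
      = \esum_(t in [set: T]) (p t)%:E + \esum_(t in [set: T]) (neg f t)%:E)%E.
  rewrite -!esumD; try by move=> t _; rewrite lee_fin.
  apply: eq_esum => t _; rewrite -!EFinD; congr (_%:E).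
  by have := posBneg f t; rewrite {1}/f; lra.
move=> /(congr1 fine); rewrite !fineD// => E.
by rewrite /rsum -/(pos f) -/(neg f); lra.
Qed.

Lemma rsum_ge0 f : (forall t, 0 <= f t) ->
  rsum f = fine (\esum_(t in [set: T]) (f t)%:E).
Proof.
move=> f0; rewrite /rsum [X in _ - fine X]esum1 ?subr0.
  by congr fine; apply: eq_esum => t _; rewrite max_l.
by move=> t _; rewrite max_r// oppr_le0.
Qed.

Lemma rsumD f h : rsummable f -> rsummable h ->
  rsum (fun t => f t + h t) = rsum f + rsum h.
Proof.
move=> sf sh.
rewrite (_ : (fun t => f t + h t) =
  fun t => (pos f t + pos h t) - (neg f t + neg h t)); last first.
  by apply/funext => t; rewrite (posBneg f) (posBneg h); ring.
have ? := summable_pos sf; have ? := summable_pos sh.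
have ? := summable_neg sf; have ? := summable_neg sh.
rewrite rsum_diff; [|by move=> t; rewrite addr_ge0..
  |exact: rsummableD|exact: rsummableD].
under eq_esum do rewrite EFinD.
under [X in _ - fine X]eq_esum do rewrite EFinD.
rewrite !esumD; try by move=> t _; rewrite lee_fin.
rewrite !fineD ?fin_num_esum// /rsum -/(pos f) -/(pos h).
rewrite opprD addrACA; congr (_ + _).
Qed.

Lemma rsumN f : rsum (fun t => - f t) = - rsum f.
Proof.
rewrite /rsum opprB; congr (_ - _); congr fine; apply: eq_esum => t _.
by rewrite opprK.
Qed.

Lemma rsumZ c f : rsum (fun t => c * f t) = c * rsum f.
Proof.
have ge0 (d : R) : 0 <= d -> rsum (fun t => d * f t) = d * rsum f.
  move=> d0; rewrite /rsum mulrBr.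
  have E h : fine (\esum_(t in [set: T]) (Num.max (d * h t) 0)%:E)
    = d * fine (\esum_(t in [set: T]) (Num.max (h t) 0)%:E).
    under eq_esum do rewrite -[X in Num.max _ X](mulr0 d) -maxr_pMr// EFinM.
    rewrite esumZl// => [|t]; last by rewrite lee_fin le_max lexx orbT.
    set S := esum _ _; have : (0 <= S)%E.
      by apply: esum_ge0 => t _; rewrite lee_fin le_max lexx orbT.
    case: S => [s|//|//] _; first by rewrite -EFinM.
    (* The sum is infinite here: both sides are 0, because [fine] sends [+oo] to 0. The case d = 0
       is split off since d * [+oo] = [+oo] requires d > 0. *)
    move: d0; rewrite le_eqVlt => /predU1P[<-|d0]; first by rewrite mul0e mul0r.
    by rewrite gt0_muley ?mulr0.
  rewrite -E; congr (_ - _); rewrite -E; congr fine; apply: eq_esum => t _.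
  by rewrite mulrN.
have [/ge0//|c0] := leP 0 c.
rewrite (_ : (fun t => c * f t) = fun t => - (- c * f t)).
  by rewrite rsumN ge0 ?oppr_ge0 ?ltW// mulNr opprK.
by apply/funext => t; rewrite mulNr opprK.
Qed.

Lemma rsum_single f (t : T) : (forall s, s != t -> f s = 0) -> rsum f = f t.
Proof.
move=> f0; rewrite /rsum !(@esum_single _ _ _ t)/= -?[RHS](esym (posBneg f t))//.
- by rewrite lee_fin neg_ge0.
- by move=> s /f0 ->; rewrite oppr0 maxxx.
- by rewrite lee_fin pos_ge0.
- by move=> s /f0 ->; rewrite maxxx.
Qed.

End RealSums.

(** * The quaternion norm *)

Section Quaternions.
Context {R : realType}.
Implicit Types x y : quat R.

Lemma qnorm_sqE x :
  qnorm x ^+ 2 = qre x ^+ 2 + qim_i x ^+ 2 + qim_j x ^+ 2 + qim_ij x ^+ 2.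
Proof. by rewrite sqr_sqrtr// !addr_ge0// sqr_ge0. Qed.

(** Euler's four-square identity. *)
Lemma qnorm_sqM x y : qnorm (x * y) ^+ 2 = qnorm x ^+ 2 * qnorm y ^+ 2.
Proof. by rewrite !qnorm_sqE; case: x y => a b c d [a' b' c' d'] /=; ring. Qed.

Lemma qnorm_sq_conj x : qnorm (qconj x) ^+ 2 = qnorm x ^+ 2.
Proof. by rewrite !qnorm_sqE /=; ring. Qed.

(** Coordinatewise this is (a - b)^2 >= 0. It stands in for the triangle inequality when showing
    that [l2] is closed under addition. *)
Lemma qnorm_sqD x y :
  qnorm (x + y) ^+ 2 <= 2 * (qnorm x ^+ 2 + qnorm y ^+ 2).
Proof.
have sqD (a b : R) : (a + b) ^+ 2 <= 2 * (a ^+ 2 + b ^+ 2).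
  by rewrite -subr_ge0 (_ : _ - _ = (a - b) ^+ 2) ?sqr_ge0//; ring.
rewrite !qnorm_sqE; case: x y => a b c d [a' b' c' d'] /=.
by have := sqD a a'; have := sqD b b'; have := sqD c c'; have := sqD d d'; lra.
Qed.

Lemma qnorm_sq0 : qnorm (0 : quat R) ^+ 2 = 0.
Proof. by rewrite qnorm_sqE /=; ring. Qed.

Lemma qnorm_sq1 : qnorm (1 : quat R) ^+ 2 = 1.
Proof. by rewrite qnorm_sqE /=; ring. Qed.

Lemma qnorm_sq_eq0 x : qnorm x ^+ 2 = 0 -> x = 0.
Proof.
rewrite qnorm_sqE; case: x => a b c d /= /eqP.
rewrite !paddr_eq0 ?addr_ge0 ?sqr_ge0// !sqrf_eq0.
by move=> /andP[/andP[/andP[/eqP-> /eqP->] /eqP->] /eqP->].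
Qed.

Lemma qconj_mul x : qconj x * x = Quat (qnorm x ^+ 2) 0 0 0.
Proof. by rewrite qnorm_sqE; case: x => a b c d; congr Quat => /=; ring. Qed.

Lemma qnorm_expi (t : R) : qnorm (expi t) ^+ 2 = 1.
Proof. by rewrite qnorm_sqE /= -(cos2Dsin2 t); ring. Qed.

Lemma qnorm_expj (t : R) : qnorm (expj t) ^+ 2 = 1.
Proof. by rewrite qnorm_sqE /= -(cos2Dsin2 t); ring. Qed.

Lemma ler_coord_qnorm x : [/\ `|qre x| <= qnorm x, `|qim_i x| <= qnorm x,
  `|qim_j x| <= qnorm x & `|qim_ij x| <= qnorm x].
Proof.
have le (a : R) : a ^+ 2 <= qnorm x ^+ 2 -> `|a| <= qnorm x.
  by rewrite -real_normK ?num_real// ler_sqr ?nnegrE ?sqrtr_ge0.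
have := sqr_ge0 (qre x); have := sqr_ge0 (qim_i x).
have := sqr_ge0 (qim_j x); have := sqr_ge0 (qim_ij x).
by split; apply: le; rewrite qnorm_sqE; lra.
Qed.

End Quaternions.

(** * Quaternion-valued sums and their right linearity *)

Definition qsummable {R : realType} {T : choiceType} (f : T -> quat R) :=
  (\esum_(t in [set: T]) (qnorm (f t))%:E < +oo)%E.

Section QuaternionSums.
Context {R : realType} {T : choiceType}.
Implicit Types f h : T -> quat R.

Lemma qsummable_coord f : qsummable f ->
  [/\ rsummable (qre \o f), rsummable (qim_i \o f),
      rsummable (qim_j \o f) & rsummable (qim_ij \o f)].
Proof.
move=> sf; split; apply: rsummable_le sf => t;
  by have [] := ler_coord_qnorm (f t).
Qed.

Lemma qsumD f h : qsummable f -> qsummable h ->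
  qsum (fun t => f t + h t) = qsum f + qsum h.
Proof.
move=> /qsummable_coord[? ? ? ?] /qsummable_coord[? ? ? ?].
by congr Quat => /=; rewrite -rsumD.
Qed.

Let rsum_comb4 (a b c d : R) (f1 f2 f3 f4 : T -> R) :
  rsummable f1 -> rsummable f2 -> rsummable f3 -> rsummable f4 ->
  rsum (fun t => a * f1 t + b * f2 t + c * f3 t + d * f4 t) =
  a * rsum f1 + b * rsum f2 + c * rsum f3 + d * rsum f4.
Proof.
move=> /(rsummableZ a) s1 /(rsummableZ b) s2 /(rsummableZ c) s3 /(rsummableZ d) s4.
have s12 := rsummableD s1 s2; have s123 := rsummableD s12 s3.
by rewrite (rsumD s123 s4) (rsumD s12 s3) (rsumD s1 s2) !rsumZ.
Qed.

(** Right multiplication by q is real-linear: each coordinate of [f t * q] is a fixed real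
    combination of the four coordinates of [f t], with the signs of the multiplication table. *)
Lemma qsumM f (q : quat R) : qsummable f ->
  qsum (fun t => f t * q) = qsum f * q.
Proof.
case: q => a b c d /qsummable_coord[s1 s2 s3 s4]; congr Quat => /=.
- transitivity (a * rsum (qre \o f) + - b * rsum (qim_i \o f)
    + - c * rsum (qim_j \o f) + - d * rsum (qim_ij \o f)); last by ring.
  rewrite -rsum_comb4//; congr rsum; apply/funext => t /=.
  by case: (f t) => ? ? ? ? /=; ring.
- transitivity (b * rsum (qre \o f) + a * rsum (qim_i \o f)
    + d * rsum (qim_j \o f) + - c * rsum (qim_ij \o f)); last by ring.
  rewrite -rsum_comb4//; congr rsum; apply/funext => t /=.
  by case: (f t) => ? ? ? ? /=; ring.
- transitivity (c * rsum (qre \o f) + - d * rsum (qim_i \o f)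
    + a * rsum (qim_j \o f) + b * rsum (qim_ij \o f)); last by ring.
  rewrite -rsum_comb4//; congr rsum; apply/funext => t /=.
  by case: (f t) => ? ? ? ? /=; ring.
- transitivity (d * rsum (qre \o f) + c * rsum (qim_i \o f)
    + - b * rsum (qim_j \o f) + a * rsum (qim_ij \o f)); last by ring.
  rewrite -rsum_comb4//; congr rsum; apply/funext => t /=.
  by case: (f t) => ? ? ? ? /=; ring.
Qed.

Lemma qsum_single f t : (forall s, s != t -> f s = 0) -> qsum f = f t.
Proof.
move=> f0; rewrite /qsum !(@rsum_single _ _ _ t) /=; first by case: (f t).
all: by move=> s /f0 /= ->.
Qed.

End QuaternionSums.

(** * The space [l2] and its inner product *)

Definition delta {R : realType} (k : Z2) : Z2 -> quat R :=
  fun k' => (k' == k)%:R.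

Section SequenceSpace.
Context {R : realType}.
Implicit Types f h : Z2 -> quat R.

Lemma normsq_ge0 f : (0 <= normsq f)%E.
Proof. by apply: esum_ge0 => k _; rewrite lee_fin sqr_ge0. Qed.

Lemma l2_fin_num f : l2 f -> normsq f \is a fin_num.
Proof. by move=> lf; rewrite ge0_fin_numE// normsq_ge0. Qed.

Lemma l2D f h : l2 f -> l2 h -> l2 (fun k => f k + h k).
Proof.
move=> lf lh.
have bound : (\esum_(k in [set: Z2])
    (2%:E * ((qnorm (f k) ^+ 2)%:E + (qnorm (h k) ^+ 2)%:E)) < +oo)%E.
  rewrite esumZl//; last by move=> k; rewrite -EFinD lee_fin addr_ge0// sqr_ge0.
  rewrite esumD; try by move=> t _; rewrite lee_fin sqr_ge0.
  rewrite lte_mul_pinfty//; exact: lte_add_pinfty.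
apply: le_lt_trans bound; apply: le_esum => k _.
by rewrite -EFinD -EFinM lee_fin qnorm_sqD.
Qed.

Lemma l2M f (q : quat R) : l2 f -> l2 (fun k => f k * q).
Proof.
move=> lf; rewrite /l2 /normsq.
under eq_esum do rewrite qnorm_sqM mulrC EFinM.
rewrite esumZl ?sqr_ge0//; last by move=> k; rewrite lee_fin sqr_ge0.
by rewrite lte_mul_pinfty ?lee_fin ?sqr_ge0.
Qed.

Lemma l2_0 : l2 (fun=> 0 : quat R).
Proof. by rewrite /l2 /normsq esum1// => k _; rewrite qnorm_sq0. Qed.

(** Termwise |f k| |h k| <= |f k|^2 + |h k|^2, checked after squaring both sides; the right-hand
    side is summable. *)
Lemma inner_summable f h : l2 f -> l2 h ->
  qsummable (fun k => qconj (f k) * h k).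
Proof.
move=> lf lh; have := lte_add_pinfty lf lh.
rewrite -esumD; try by move=> t _; rewrite lee_fin sqr_ge0.
apply: le_lt_trans; apply: le_esum => k _; rewrite -EFinD lee_fin.
rewrite -ler_sqr ?nnegrE ?sqrtr_ge0// ?addr_ge0 ?sqr_ge0//.
rewrite qnorm_sqM qnorm_sq_conj.
have := sqr_ge0 (qnorm (f k)); have := sqr_ge0 (qnorm (h k)).
by nra.
Qed.

Lemma innerDr f h h' : l2 f -> l2 h -> l2 h' ->
  inner f (fun k => h k + h' k) = inner f h + inner f h'.
Proof.
move=> lf lh lh'; rewrite /inner -qsumD; try exact: inner_summable.
by congr qsum; apply/funext => k; rewrite mulrDr.
Qed.

Lemma innerMr f h (q : quat R) : l2 f -> l2 h ->
  inner f (fun k => h k * q) = inner f h * q.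
Proof.
move=> lf lh; rewrite /inner -qsumM; last exact: inner_summable.
by congr qsum; apply/funext => k; rewrite mulrA.
Qed.

Lemma inner_self f : l2 f -> inner f f = Quat (fine (normsq f)) 0 0 0.
Proof.
move=> lf; have zero : rsum (fun _ : Z2 => 0 : R) = 0.
  by rewrite rsum_ge0// esum1.
rewrite /inner (_ : (fun k => _) = fun k => Quat (qnorm (f k) ^+ 2) 0 0 0).
  by rewrite /qsum /comp /= zero rsum_ge0// => k; exact: sqr_ge0.
by apply/funext => k; rewrite qconj_mul.
Qed.

(** Computes the diagonal term, the one of index a, in the Parseval identity tested on [u a]. *)
Lemma qnorm_inner_self f : l2 f ->
  ((qnorm (inner f f) ^+ 2)%:E = normsq f * normsq f)%E.
Proof.
move=> lf; rewrite inner_self// qnorm_sqE /= -{2 3}[normsq f]fineK ?l2_fin_num//.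
by rewrite -EFinM; congr EFin; ring.
Qed.

Lemma normsq_delta k : normsq (delta k : Z2 -> quat R) = 1%E.
Proof.
rewrite /normsq (@esum_single _ _ _ k) /delta ?eqxx ?qnorm_sq1 ?lee_fin//.
by move=> s /negbTE ->; rewrite qnorm_sq0.
Qed.

Lemma inner_delta f k : inner f (delta k) = qconj (f k).
Proof.
rewrite /inner (@qsum_single _ _ _ k) /delta ?eqxx ?mulr1//.
by move=> s /negbTE ->; rewrite mulr0.
Qed.

End SequenceSpace.

(** * Finite right-linear combinations *)

Section SpanSums.
Context {R : realType} {I : choiceType}.
Variable u : I -> Z2 -> quat R.
Hypothesis l2u : forall a, l2 (u a).

Lemma l2_span s (q : I -> quat R) : l2 (fun k => \sum_(a <- s) u a k * q a).
Proof.
elim: s => [|a s IHs].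
  rewrite (_ : (fun k => _) = fun=> 0); first exact: l2_0.
  by apply/funext => k; rewrite big_nil.
rewrite (_ : (fun k => _) =
    fun k => u a k * q a + \sum_(a <- s) u a k * q a).
  by apply: l2D => //; exact: l2M.
by apply/funext => k; rewrite big_cons.
Qed.

Lemma inner_span f s (q : I -> quat R) : l2 f ->
  inner f (fun k => \sum_(a <- s) u a k * q a)
  = \sum_(a <- s) inner f (u a) * q a.
Proof.
move=> lf; elim: s => [|a s IHs].
  (* The empty combination is the zero function, written as f times the scalar 0 so that [innerMr]
     evaluates it. *)
  rewrite big_nil -[RHS](mulr0 (inner f f)) -innerMr//; congr inner.
  by apply/funext => k; rewrite big_nil mulr0.
rewrite big_cons -IHs -innerMr// -innerDr//; [|exact: l2M|exact: l2_span].
by congr inner; apply/funext => k; rewrite big_cons.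
Qed.

End SpanSums.

(** * Parseval families in [l2] *)

Lemma le_esum2 (R : realType) (T : choiceType) (F : T -> \bar R) (a b : T) :
  (forall t, 0 <= F t)%E -> a != b ->
  (F a + F b <= \esum_(t in [set: T]) F t)%E.
Proof.
move=> F0 ab; rewrite (esumID [set a])// setTI esum_set1// leeD2l// setTI.
apply: esum_ge; exists [set b]; last by rewrite fsbig_set1.
by split; [exact: finite_set1 | move=> _ -> /= ba; rewrite ba eqxx in ab].
Qed.

Section ParsevalFamilies.
Context {R : realType} {I : choiceType}.
Variable u : I -> Z2 -> quat R.
Hypothesis l2u : forall a, l2 (u a).
Hypothesis parseval : forall h : Z2 -> quat R, l2 h ->
  (\esum_(a in [set: I]) (qnorm (inner (u a) h) ^+ 2)%:E = normsq h)%E.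

Let coef_ge0 (h : Z2 -> quat R) a :
  (0 <= (qnorm (inner (u a) h) ^+ 2)%:E)%E.
Proof. by rewrite lee_fin sqr_ge0. Qed.

(** In the Parseval identity for [u a], the term of index a is the square of [normsq (u a)], and it
    cannot exceed the total [normsq (u a)]. *)
Lemma parseval_normsq_le1 a : (normsq (u a) <= 1)%E.
Proof.
have := le_esum1 a (coef_ge0 (u a)).
rewrite parseval// qnorm_inner_self//.
have := normsq_ge0 (u a); have := l2_fin_num (l2u a).
case: (normsq (u a)) => [x|//|//] _; rewrite -EFinM !lee_fin => x0 xx.
by have [//|x1] := leP x 1; nra.
Qed.

(** In the Parseval identity for [u b], the term of index b equals 1 and already exhausts the total,
    so every other coefficient vanishes. *)
Lemma parseval_orthonormal : (forall a, normsq (u a) = 1%E) -> Defs.orthonormal u.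
Proof.
move=> u1 a b; have [->|ab] := eqVneq a b; first by rewrite inner_self// u1.
have := le_esum2 (coef_ge0 (u b)) ab.
rewrite parseval// qnorm_inner_self// u1 mule1 -EFinD lee_fin => le0.
apply: qnorm_sq_eq0; have := sqr_ge0 (qnorm (inner (u a) (u b))).
by move=> ge0; apply/eqP; rewrite eq_le ge0 andbT; lra.
Qed.

(* The residual of the expansion of h over a finite s has coefficients those
   of h outside s and zero on s, so its norm is a tail of a convergent sum. *)
Lemma parseval_total : Defs.orthonormal u -> right_total u.
Proof.
move=> ou h lh e e0; pose A a := ((qnorm (inner (u a) h) ^+ 2)%:E : \bar R).
have A0 a : (0 <= A a)%E by rewrite lee_fin sqr_ge0.
have AF : \esum_(a in [set: I]) A a \is a fin_num.
  by rewrite parseval// l2_fin_num.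
have e20 : 0 < e ^+ 2 by rewrite exprn_gt0.
have [_ [X [finX _] <-] AX] := ub_ereal_sup_adherent e20 AF.
rewrite -/(esum _ _) in AX.
pose s := finmap.enum_fset (fset_set X); pose q a := inner (u a) h.
have us : uniq s := finmap.fset_uniq _.
have sX a : (a \in s) = (a \in X) by rewrite in_fset_set.
exists s, q; pose r k := h k - \sum_(a <- s) u a k * q a.
have lS := l2_span l2u s q.
have rE : r = fun k => h k + (\sum_(a <- s) u a k * q a) * (-1).
  by apply/funext => k; rewrite mulrN1.
have lr : l2 r by rewrite rE; apply: l2D => //; exact: l2M.
have inner_r b : inner (u b) r = if b \in X then 0 else q b.
  rewrite rE innerDr//; last exact: l2M.
  rewrite innerMr// inner_span// mulrN1 -sX -/(q b).
  have [bs|bs] := boolP (b \in s).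
    rewrite (bigD1_seq b)//= ou eqxx mul1r big1 ?addr0 ?subrr// => a ab.
    by rewrite ou eq_sym (negbTE ab) mul0r.
  rewrite big_seq big1 ?subr0// => a as'; rewrite ou.
  by case: eqP => [ba|_]; [rewrite ba as' in bs | rewrite mul0r].
rewrite -/(r) -(parseval lr).
have AE : (\esum_(a in [set: I]) A a =
    \sum_(a \in X) A a + \esum_(a in [set: I]) (qnorm (inner (u a) r) ^+ 2)%:E)%E.
  rewrite (esumID X)// !setTI esum_fset//; congr (_ + _)%E.
  rewrite esum_mkcond; apply: eq_esum => a _; rewrite inner_r in_setC.
  by case: (a \in X); rewrite //= qnorm_sq0.
move: AX AF; rewrite AE.
set x := (\sum_(a \in X) A a)%E; set y := esum _ _ => xy.
rewrite fin_numD => /andP[]; move: xy; case: x => [x|//|//].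
by case: y => [y|//|//] + _ _; rewrite -!EFinD !lte_fin; lra.
Qed.

Lemma parseval_basisP :
  orthonormal_basis u <-> forall a, normsq (u a) = 1%E.
Proof.
split=> [[_ ou _] a|u1].
  have := ou a a; rewrite eqxx inner_self// => -[] /= fine1.
  by rewrite -[LHS]fineK ?l2_fin_num// fine1.
have ou := parseval_orthonormal u1.
by split=> //; exact: parseval_total.
Qed.

End ParsevalFamilies.

(** * Cosets of the lattice of multiples of N *)

Section LatticeCosets.
Variables (N : nat) (N_gt0 : (0 < N)%N).

Lemma coset_inj (i j : 'I_N) (m n : int) :
  i%:Z - m * N%:Z = j%:Z - n * N%:Z -> i = j /\ m = n.
Proof.
have N0 : N%:Z != 0 by rewrite eqz_nat -lt0n.
(* Both components are read off by Euclidean division by N: k is the remainder and -a the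
   quotient. *)
have mE (k : 'I_N) (a : int) :
    ((k%:Z - a * N%:Z) %% N%:Z)%Z = k%:Z /\ ((k%:Z - a * N%:Z) %/ N%:Z)%Z = - a.
  rewrite -mulNr [_ + _]addrC modzMDl divzMDl// modz_small ?divz_small ?addr0//.
    by rewrite !ltz_nat ltn_ord.
  by rewrite ltz_nat ltn_ord.
have [r1 q1] := mE i m; have [r2 q2] := mE j n.
move=> e; split; last by apply: oppr_inj; rewrite -q1 e q2.
by apply: val_inj; apply/eqP; rewrite -eqz_nat -r1 e r2.
Qed.

Lemma coset_surj (x : int) : exists (i : 'I_N) (n : int), i%:Z - n * N%:Z = x.
Proof.
have N0 : N%:Z != 0 by rewrite eqz_nat -lt0n.
have := modz_ge0 x N0; have := ltz_mod x N0; have := divz_eq x N%:Z.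
case: (x %% N%:Z)%Z => [r|//]; rewrite ltz_nat => xE rN _.
(* The quotient changes sign because the coset representation subtracts the multiple of N. *)
by exists (Ordinal rN), (- (x %/ N%:Z)%Z); rewrite [RHS]xE mulNr opprK addrC.
Qed.

(** The box of side N is a set of representatives for the cosets of the lattice, so (i, n) -> i - nN
    is a bijection onto [Z2] along which the sum is reindexed. *)
Lemma esum_cosets (R : realType) (F : Z2 -> \bar R) : (forall k, 0 <= F k)%E ->
  (\sum_(i : 'I_N * 'I_N) \esum_(n in [set: Z2])
     F (i.1%:Z - n.1 * N%:Z, i.2%:Z - n.2 * N%:Z)%R
   = \esum_(k in [set: Z2]) F k)%E.
Proof.
move=> F0; pose e (p : 'I_N * 'I_N * Z2) : Z2 :=
  (p.1.1%:Z - p.2.1 * N%:Z, p.1.2%:Z - p.2.2 * N%:Z).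
rewrite [RHS](@reindex_esum _ _ _ [set: _] [set: Z2] e).
  by rewrite (esum_fin_prod (F := F \o e))//= => p; exact: F0.
split => //.
- move=> [[i1 i2] [m1 m2]] [[j1 j2] [n1 n2]] _ _ [].
  by move=> /coset_inj[-> ->] /coset_inj[-> ->].
- move=> [x1 x2] _; have [i1 [n1 <-]] := coset_surj x1.
  by have [i2 [n2 <-]] := coset_surj x2; exists ((i1, i2), (n1, n2)).
Qed.

End LatticeCosets.

(** * Norms and density of Gabor systems *)

Section GaborSystems.
Context {R : realType} {L M N : nat}.
Variable g : 'I_L -> Z2 -> quat R.

(** The modulation multiplies by unit quaternions on both sides. *)
Lemma qnorm_gabor l m n (k : Z2) :
  qnorm (gabor N g ((l, m, n) : gabor_index L M) k) ^+ 2
  = qnorm (g l (k.1 - n.1 * N%:Z, k.2 - n.2 * N%:Z)) ^+ 2.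
Proof. by rewrite !qnorm_sqM qnorm_expi qnorm_expj mul1r mulr1. Qed.

Lemma normsq_gabor (a : gabor_index L M) : normsq (gabor N g a) = normsq (g a.1.1).
Proof.
case: a => -[l m] n /=; rewrite /normsq.
pose e (k : Z2) : Z2 := (k.1 - n.1 * N%:Z, k.2 - n.2 * N%:Z).
rewrite [RHS](@reindex_esum _ _ _ [set: Z2] [set: Z2] e).
  by apply: eq_esum => k _; rewrite qnorm_gabor.
split=> //; first by move=> [a b] [c d] _ _ [] /addIr -> /addIr ->.
move=> [a b] _; exists (a + n.1 * N%:Z, b + n.2 * N%:Z) => //.
by rewrite /e /= !addrK.
Qed.

(** Turns the iterated sum over l, n, m into one sum over the index type, the form in which the
    results on Parseval families apply. *)
Lemma gabor_parsevalE : gabor_parseval M N g -> forall h, l2 h ->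
  (\esum_(a in [set: gabor_index L M])
     (qnorm (inner (gabor N g a) h) ^+ 2)%:E = normsq h)%E.
Proof.
move=> hP h lh; rewrite -hP//.
pose F (a : gabor_index L M) := ((qnorm (inner (gabor N g a) h) ^+ 2)%:E : \bar R).
rewrite (esum_fin_prod (F := F)); last by move=> a; rewrite lee_fin sqr_ge0.
transitivity (\sum_(l < L) \sum_(m : 'I_M * 'I_M)
    \esum_(n in [set: Z2]) F (l, m, n))%E.
  by rewrite pair_bigA; apply: eq_bigr => -[].
apply: eq_bigr => l _; rewrite -esum_sum// => n m _ _.
by rewrite lee_fin sqr_ge0.
Qed.

Lemma gabor_parseval_density : (0 < N)%N -> gabor_parseval M N g ->
  ((M ^ 2)%:R%:E * \sum_(l < L) normsq (g l) = (N ^ 2)%:R%:E :> \bar R)%E.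
Proof.
move=> N0 hP.
have at_point (i : 'I_N * 'I_N) : ((M ^ 2)%:R%:E * \sum_(l < L)
    \esum_(n in [set: Z2])
      (qnorm (g l (i.1%:Z - n.1 * N%:Z, i.2%:Z - n.2 * N%:Z)%R) ^+ 2)%:E
    = 1 :> \bar R)%E.
  rewrite -(normsq_delta (i.1%:Z, i.2%:Z)) -hP; last first.
    by rewrite /l2 normsq_delta ltry.
  rewrite ge0_sume_distrr; last first.
    by move=> l _; apply: esum_ge0 => n _; rewrite lee_fin sqr_ge0.
  apply: eq_bigr => l _; rewrite -esumZl//; last first.
    by move=> n; rewrite lee_fin sqr_ge0.
  apply: eq_esum => n _.
  (* The terms do not depend on m, so the sum over the modulations only contributes the factor
     M^2. *)
  under eq_bigr do rewrite inner_delta qnorm_sq_conj qnorm_gabor.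
  by rewrite sumEFin sumr_const card_prod card_ord -EFinM mulr_natl.
(* N^2 counts the points of the box; each 1 is then replaced by the Parseval identity at that
   point. *)
transitivity (\sum_(i : 'I_N * 'I_N) (1%:E : \bar R))%E; last first.
  by rewrite sumEFin sumr_const card_prod card_ord.
rewrite [RHS](eq_bigr _ (fun i _ => esym (at_point i))).
rewrite -ge0_sume_distrr; last first.
  move=> i _; apply: sume_ge0 => l _; apply: esum_ge0 => n _.
  by rewrite lee_fin sqr_ge0.
(* For a fixed window, the box and lattice sums together run once over all of [Z2]. *)
congr (_ * _)%E; rewrite exchange_big/=; apply: eq_bigr => l _.
rewrite (esum_cosets N0 (F := fun k => (qnorm (g l k) ^+ 2)%:E))// => k.
by rewrite lee_fin sqr_ge0.
Qed.

End GaborSystems.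

Theorem theorem4 (R : realType) (L M N : nat)
    (hL : (0 < L)%N) (hM : (0 < M)%N) (hN : (0 < N)%N)
    (g : 'I_L -> Z2 -> quat R) (hg : forall l, l2 (g l))
    (hP : gabor_parseval M N g) :
  orthonormal_basis (gabor (M := M) N g) <-> (N ^ 2 = L * M ^ 2)%N.
Proof.
have l2u a : l2 (gabor (M := M) N g a) by rewrite /l2 normsq_gabor; exact: hg.
have parseval := gabor_parsevalE hP.
(* Every window occurs in the system: M > 0 provides the modulation index 0. Bounds on the Gabor
   elements thus pass to the windows. *)
have index_of l : exists a : gabor_index L M, a.1.1 = l.
  by exists (l, (Ordinal hM, Ordinal hM), (0, 0)).
pose x l := fine (normsq (g l)).
have xE l : normsq (g l) = (x l)%:E by rewrite fineK// l2_fin_num.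
have x_le1 l : x l <= 1.
  have [a <-] := index_of l; rewrite -lee_fin -xE -(normsq_gabor (N := N) g).
  exact: parseval_normsq_le1.
have density : (M ^ 2)%:R * \sum_(l < L) x l = (N ^ 2)%:R.
  apply: EFin_inj; rewrite EFinM -(gabor_parseval_density hN hP) -sumEFin.
  by under eq_bigr do rewrite -xE.
rewrite parseval_basisP//; split=> [u1|NLM a].
  (* The equation is moved to R, where [density] holds; with all [x l] equal to 1 its sum is L. *)
  apply/eqP; rewrite -(eqr_nat R) -density mulnC natrM; apply/eqP; congr (_ * _).
  rewrite (eq_bigr (fun=> 1)) ?sumr_const ?card_ord// => l _.
  by have [a <-] := index_of l; apply: EFin_inj; rewrite -xE -(normsq_gabor (N := N) g).
rewrite normsq_gabor xE; congr (_%:E); apply/esym/eqP; rewrite -subr_eq0.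
have M2 : (M ^ 2)%:R != 0 :> R by rewrite pnatr_eq0 -lt0n expn_gt0 hM.
(* Under N^2 = L M^2 the [x l] sum to L. Since each is at most 1, the deficits 1 - [x l] are
   nonnegative with sum 0, so each of them vanishes. *)
have sum0 : \sum_(l < L) (1 - x l) = 0.
  rewrite sumrB sumr_const card_ord; apply: (mulfI M2).
  by rewrite mulr0 mulrBr density NLM natrM [_ * L%:R]mulrC subrr.
apply/eqP; apply: (psumr_eq0P _ sum0) => // l _.
by rewrite subr_ge0.
Qed.
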